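(* Let $\mathbb{F}_q$ be a finite field of characteristic $p$, and let $n$ be an odd prime number different from $p$. Define $f:\{1,\ldots,n\}\to\mathbb{F}_q$ by $f(n)=0$ and, for $1\le i\le n-1$, $f(i)=0$ if $i$ is a quadratic residue modulo $n$ and $f(i)=1$ if $i$ is a quadratic nonresidue modulo $n$. If $p$ does not divide the integer closest to $n/4$, then $f$ is $D$-complicated.
   Context: Let $\mathbb{F}_q$ be a finite field with $q$ elements and let $n$ be a natural number. Let $M=\mathbb{F}_q^n$ be the set of all closed (cyclic) sequences $x=(x_1,\ldots,x_n)$ of $n$ elements of $\mathbb{F}_q$, with the convention $x_{n+1}=x_1$. The finite difference operator $\Delta:M\to M$ is defined by $(\Delta x)_i=x_{i+1}-x_i$, $i=1,\ldots,n$. A differential operator is any linear operator $D:M\to M$ representable in the form $D=\sum_{i=1}^m d_i\Delta^i$ with $m\ge 1$ and $d_i\in\mathbb{F}_q$ (no constant term). For a given $D$ and $x\in M$, the sequence $x,Dx,D^2x,\ldots$ is eventually periodic; its period is the length of the cycle it eventually enters, and its preperiod is the least $k\ge 0$ such that $D^kx$ lies on that cycle. A function $f:\{1,\ldots,n\}\to\mathbb{F}_q$ is identified with the sequence $x\in M$, $x_i=f(i)$. The function $f$ is called almost most complicated for $D$ if the period of $x,Dx,D^2x,\ldots$ is the maximum of the periods over all initial vectors in $M$, and the preperiod of $x,Dx,D^2x,\ldots$ differs by at most one from the maximum of the preperiods over all initial vectors in $M$. The function $f$ is called $D$-complicated if it is almost most complicated for every differential operator $D$. *)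

(* Defs.v *)
From HB Require Import structures.
From mathcomp Require Import all_boot all_order all_algebra.

Set Implicit Arguments.
Unset Strict Implicit.
Unset Printing Implicit Defensive.

Import Order.TTheory GRing.Theory Num.Theory.
Local Open Scope ring_scope.

Section EventualPeriod.

Variables (T : finType) (g : T -> T).

(* Some iterate of g of order at least 1 maps y to itself. *)
Definition on_cycle (y : T) : bool := fconnect g (g y) y.

Lemma ex_on_cycle (x : T) : exists k, on_cycle (iter k g x).
Proof.
have /trajectP[i lt_i eq_i] := looping_order g x.
exists i; rewrite /on_cycle -[X in fconnect _ _ X]eq_i.
by rewrite -(subnK lt_i) iterD iterS fconnect_iter.
Qed.

Definition preperiod (x : T) : nat := ex_minn (ex_on_cycle x).

(* [order g y] counts the points reachable from y, which for y on a cycle is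
   the length of that cycle. *)
Definition period (x : T) : nat := order g (iter (preperiod x) g x).

(* The truncated subtraction is exact: the maximum is over all points. *)
Definition almost_most_complicated (x : T) : Prop :=
  period x = (\max_(y : T) period y)%N /\
  (\max_(y : T) preperiod y - preperiod x <= 1)%N.

End EventualPeriod.

Section Complicated.

Variables (F : finFieldType) (n : nat).

(* The term x_i of a closed sequence, 1 <= i <= n, is stored at the ordinal
   i - 1; [ordS] is the cyclic successor, so that x_(n+1) = x_1. *)
Definition Delta (x : 'rV[F]_n) : 'rV[F]_n :=
  \row_(j < n) (x 0 (ordS j) - x 0 j).

Definition differential_operator (D : {linear 'rV[F]_n -> 'rV[F]_n}) : Prop :=
  exists (m : nat) (d : nat -> F), (1 <= m)%N /\
    forall x, D x = \sum_(1 <= i < m.+1) d i *: iter i Delta x.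

(* A function on {1, ..., n} is given as a function on nat, of which only the
   values at 1, ..., n are used. *)
Definition closed_seq (f : nat -> F) : 'rV[F]_n := \row_(j < n) f j.+1.

Definition D_complicated (f : nat -> F) : Prop :=
  forall D : {linear 'rV[F]_n -> 'rV[F]_n},
    differential_operator D -> almost_most_complicated D (closed_seq f).

End Complicated.

Definition quadratic_residue (n a : nat) : bool :=
  coprime a n && [exists x : 'I_n, x ^ 2 == a %[mod n]]%N.

Definition nonresidue_indicator (F : finFieldType) (n i : nat) : F :=
  if i == n then 0 else if quadratic_residue n i then 0 else 1.

Definition closest_integer (x : rat) (m : int) : Prop :=
  forall k : int, `|x - m%:~R| <= `|x - k%:~R|.

(* Main.v *)
Require Import Defs.
From HB Require Import structures.
From mathcomp Require Import all_boot all_order all_algebra.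
From mathcomp Require Import zify ring.

(** View the closed sequences as functions on the field [K = 'F_n], that is, as
    the group algebra of the additive group of [K] with convolution as product.
    A differential operator [D] commutes with convolutions and kills constants.
    So suppose that [f] is invertible up to constants: every sequence [y] is,
    up to a constant, the convolution of [f] with some [h].  Then [D^k y] is
    the convolution of [D^k f] with [h] for all [k >= 1], and any coincidence
    [D^a f = D^b f] with [a, b >= 1] forces [D^a y = D^b y].  Hence the period
    of [y] is at most that of [f], and its preperiod exceeds that of [f] by at
    most one ([almost_most_complicated_dominating],
    [almost_most_complicated_cyclic]).

    It remains to invert [f], the indicator of the nonsquares of [K], up to
    constants.  Convolve it with the indicator of the nonzero squares.
    Multiplication by any [t != 0] fixes or exchanges the two indicators, so
    the result takes a single value [l] outside 0 ([convolution_neq0]).  It is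
    therefore [e] times the unit impulse plus a constant, where [e] is its value
    at 0 minus [l].  Summing over [K] determines both values
    ([convolution_values]): [e = - l] if [n = 4 l + 1] and [e = l + 1] if
    [n = 4 l + 3].  In both cases [e] is, up to sign, the integer closest to
    [n / 4], which is invertible in [F] by hypothesis.  This is the
    evaluation of the squared quadratic Gauss sum, carried out without roots of
    unity. *)

Set Implicit Arguments.
Unset Strict Implicit.
Unset Printing Implicit Defensive.

Import Order.TTheory GRing.Theory Num.Theory.
Local Open Scope ring_scope.

(** * Orbits of a self-map of a finite set *)

Section Orbits.

Variables (T : finType) (g : T -> T).

Lemma on_cycleP (y : T) :
  reflect (exists k, iter k.+1 g y = y) (on_cycle g y).
Proof. by apply: (iffP idP) => [/(orbitPcycle 2 3)|/(orbitPcycle 3 2)]. Qed.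

Lemma on_cycle_preperiod (y : T) : on_cycle g (iter (preperiod g y) g y).
Proof. by rewrite /preperiod; case: ex_minnP. Qed.

Lemma iter_period (y : T) :
  iter (period g y + preperiod g y) g y = iter (preperiod g y) g y.
Proof. by rewrite iterD; apply/(orbitPcycle 2 4)/on_cycle_preperiod. Qed.

Lemma order_le_return (w : T) P : iter P.+1 g w = w -> (order g w <= P.+1)%N.
Proof.
move=> returns; have /loopingP loops : looping g w P.+1.
  by rewrite /looping returns mem_head.
rewrite /order -[X in (_ <= X)%N](size_traject g w).
apply: leq_trans (card_size _); apply/subset_leq_card/subsetP => z.
by move=> /iter_findex <-.
Qed.

(** Points of the orbit of [y] that lie on the cycle are iterates of one another
    in both directions, so a return time of one of them is a return time of
    all. *)
Lemma preperiod_period_le (y : T) k P :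
  iter (P.+1 + k) g y = iter k g y ->
  (preperiod g y <= k)%N /\ (period g y <= P.+1)%N.
Proof.
move=> returns.
have le_k : (preperiod g y <= k)%N.
  rewrite /preperiod; case: ex_minnP => m _; apply.
  by apply/on_cycleP; exists P; rewrite -iterD.
split=> //; apply: order_le_return.
set w := iter (preperiod g y) g y.
have w_cyc : iter (period g y) g w = w by rewrite -iterD iter_period.
have w_cyc_mul m : iter (m * period g y) g w = w.
  by elim: m => [|m IHm] //; rewrite mulSn iterD IHm.
have period_gt0 : (0 < period g y)%N := order_gt0 _ _.
have eq_k : iter k g y = iter (k - preperiod g y) g w by rewrite -iterD subnK.
set j := (k - preperiod g y)%N in eq_k.
(* [w] is recovered from [iter k g y] by going on to the next multiple of the
   period. *)
have eq_w : w = iter (j * period g y - j) g (iter k g y).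
  by rewrite eq_k -iterD subnK ?w_cyc_mul // leq_pmulr.
by rewrite [in LHS]eq_w -iterD addnC iterD -(iterD P.+1) returns -eq_w.
Qed.

(** One step may be lost in the preperiod because [x] is only compared with [y]
    after the map has been applied once. *)
Lemma almost_most_complicated_dominating (x : T) :
  (forall y a b, iter a.+1 g x = iter b.+1 g x ->
                 iter a.+1 g y = iter b.+1 g y) ->
  almost_most_complicated g x.
Proof.
move=> dominates.
have bound y : (preperiod g y <= (preperiod g x).+1)%N /\
               (period g y <= period g x)%N.
  have period_gt0 : (0 < period g x)%N := order_gt0 _ _.
  rewrite -(prednK period_gt0); apply: preperiod_period_le.
  rewrite (prednK period_gt0) addnS; apply: dominates.
  by rewrite !iterS iter_period.
split.
  apply/eqP; rewrite eqn_leq (leq_bigmax x) /=.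
  by apply/bigmax_leqP => y _; case: (bound y).
rewrite leq_subLR addn1; apply/bigmax_leqP => y _.
by case: (bound y).
Qed.

End Orbits.

(** * Squares in a finite field of odd order *)

Section Squares.

Variable K : finFieldType.
Hypothesis odd_K : odd #|K|.

Definition is_square (b : K) : bool := [exists x : K, x ^+ 2 == b].

Definition squares : {set K} := [set b | (b != 0) && is_square b].
Definition nonsquares : {set K} := [set b | ~~ is_square b].

Lemma is_square_sqr (x : K) : is_square (x ^+ 2).
Proof. by apply/existsP; exists x. Qed.

Lemma squareP (b : K) :
  reflect (exists2 x, x != 0 & b = x ^+ 2) (b \in squares).
Proof.
rewrite inE; apply: (iffP andP).
  case=> b_neq0 /existsP[x /eqP eq_b]; exists x => //.
  by apply: contraNneq b_neq0 => x0; rewrite -eq_b x0 expr0n.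
by case=> x x_neq0 ->; rewrite expf_neq0 ?is_square_sqr.
Qed.

Lemma nonsquare_neq0 (b : K) : b \in nonsquares -> b != 0.
Proof.
rewrite inE; apply: contraNneq => ->.
by rewrite -[0](expr0n K 2) is_square_sqr.
Qed.

Lemma mem_nonsquares (b : K) :
  (b \in nonsquares) = (b != 0) && (b \notin squares).
Proof.
have [->|b_neq0] := eqVneq b 0.
  by apply: contraTF isT => /nonsquare_neq0; rewrite eqxx.
by rewrite !inE b_neq0.
Qed.

(** Translating the sum of all elements by [1] adds [#|K|] times [1] to it. *)
Lemma natr_card_eq0 : #|K|%:R = 0 :> K.
Proof.
have : \sum_(x : K) x = \sum_(x : K) (x + 1) by exact: (reindex_inj (addIr 1)).
by rewrite big_split /= sumr_const -[LHS]addr0 => /addrI <-.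
Qed.

Lemma two_neq0 : 2%:R != 0 :> K.
Proof.
apply: contra_eqN natr_card_eq0 => /eqP two0.
rewrite -[#|K|]odd_double_half odd_K -muln2 natrD natrM two0 mulr0 addr0.
exact: oner_neq0.
Qed.

(** Every nonzero square has exactly the two square roots [y] and [- y]. *)
Lemma card_squares : #|squares|.*2.+1 = #|K|.
Proof.
rewrite -[RHS](cardsC [set 0]) cards1 add1n; congr _.+1.
rewrite -[RHS]sum1_card (partition_big (fun x => x ^+ 2) (mem squares)) /=.
  rewrite (eq_bigr (fun=> 2%N)) ?sum_nat_const ?muln2 // => b.
  case/squareP => y y_neq0 ->.
  rewrite (eq_bigl (mem [set y; - y])) ?sum1_card ?cards2.
    rewrite -subr_eq0 opprK -mulr2n -mulr_natr mulf_eq0 negb_or y_neq0.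
    by rewrite two_neq0.
  move=> x; rewrite !inE eqf_sqr.
  case: (eqVneq x 0) => [->|//] /=.
  by rewrite eq_sym (negPf y_neq0) eq_sym oppr_eq0 (negPf y_neq0).
by move=> x; rewrite !inE => x_neq0; rewrite expf_neq0 ?is_square_sqr.
Qed.

Lemma card_nonsquares : #|nonsquares| = #|squares|.
Proof.
have : (#|squares| + #|nonsquares| = #|K|.-1)%N.
  rewrite -[#|K|](cardsC [set 0]) cards1 add1n /=.
  rewrite -(cardsID squares (~: [set 0])).
  congr (_ + _)%N; apply: eq_card => b; last first.
    by rewrite mem_nonsquares !inE andbC.
  by rewrite !inE; case: (b != 0).
by rewrite -card_squares /= -addnn => /addnI.
Qed.

Lemma mul_square (t b : K) :
  t \in squares -> (t * b \in squares) = (b \in squares).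
Proof.
case/squareP => x x_neq0 ->; apply/squareP/squareP => -[y y_neq0].
  move=> eq_y.
  exists (y / x); first by rewrite mulf_neq0 ?invr_neq0.
  by rewrite expr_div_n -eq_y mulrC mulKf ?expf_neq0.
by move=> ->; exists (x * y); rewrite ?mulf_neq0 ?exprMn.
Qed.

(** Multiplication by a nonsquare [t] sends squares to nonsquares; as there are
    equally many of both, every nonsquare is [t * r] with [r] a square, and
    [t * (t * r)] is a square again. *)
Lemma mul_nonsquare (t b : K) :
  t \in nonsquares -> (t * b \in squares) = (b \in nonsquares).
Proof.
move=> t_non; have t_neq0 := nonsquare_neq0 t_non.
have image_t : [set t * r | r in squares] = nonsquares.
  apply/eqP; rewrite eqEcard card_nonsquares (card_imset _ (mulfI t_neq0)).
  rewrite leqnn andbT; apply/subsetP => _ /imsetP[r r_sq ->].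
  have r_neq0 : r != 0 by move: r_sq; rewrite inE => /andP[].
  rewrite mem_nonsquares mulf_neq0 //= mulrC mul_square //.
  by move: t_non; rewrite mem_nonsquares => /andP[].
apply/idP/idP => [tb_sq|]; last first.
  rewrite -{1}image_t => /imsetP[r r_sq ->].
  by rewrite mulrA -expr2 mul_square //; apply/squareP; exists t.
rewrite mem_nonsquares; apply/andP; split.
  by apply: contraTneq tb_sq => ->; rewrite mulr0 !inE eqxx.
apply: contraTN tb_sq => b_sq.
have : t * b \in nonsquares by rewrite -image_t; apply/imsetP; exists b.
by rewrite mem_nonsquares => /andP[].
Qed.

Lemma mul_nonsquare_nonsquares (t b : K) :
  t \in nonsquares -> (t * b \in nonsquares) = (b \in squares).
Proof.
move=> t_non; rewrite mem_nonsquares mul_nonsquare // mem_nonsquares.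
rewrite mulf_eq0 (negPf (nonsquare_neq0 t_non)) /=.
by rewrite inE; case: (b != 0); rewrite //= negbK.
Qed.

Lemma mul_square_nonsquares (t b : K) :
  t \in squares -> (t * b \in nonsquares) = (b \in nonsquares).
Proof.
move=> t_sq; rewrite !mem_nonsquares mul_square // mulf_eq0.
by move: t_sq; rewrite inE => /andP[/negPf-> _].
Qed.

(** The convolution of the indicators of the squares and of the nonsquares. *)
Definition convolution (a : K) : nat :=
  \sum_(b : K) (b \in squares) * ((a - b)%R \in nonsquares).

(** Multiplication by [t] fixes both indicators or exchanges them, and the
    convolution is symmetric in them. *)
Lemma convolution_mul (t a : K) :
  t != 0 -> convolution (t * a) = convolution a.
Proof.
move=> t_neq0; rewrite /convolution (reindex_inj (mulfI t_neq0)) /=.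
have [t_sq|t_nsq] := boolP (t \in squares).
  by apply: eq_bigr => b _; rewrite mul_square // -mulrBr mul_square_nonsquares.
have t_non : t \in nonsquares by rewrite mem_nonsquares t_neq0.
rewrite [RHS](reindex_inj (inv_inj (subKr a))) /=.
apply: eq_bigr => b _.
by rewrite mul_nonsquare // -mulrBr mul_nonsquare_nonsquares // subKr mulnC.
Qed.

Lemma convolution_neq0 (a : K) : a != 0 -> convolution a = convolution 1.
Proof. by move=> a_neq0; rewrite -[a]mulr1 convolution_mul. Qed.

(** At 0 each [b] is paired with [- b], which is of the same kind as [b] if
    [-1] is a square and of the opposite kind otherwise. *)
Lemma convolution0 :
  convolution 0 = if -1 \in squares then 0%N else #|squares|.
Proof.
rewrite /convolution; under eq_bigr do rewrite sub0r -mulN1r.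
case: ifPn => [m1_sq|m1_nsq].
  rewrite big1 // => b _; rewrite mul_square_nonsquares // mem_nonsquares.
  by case: (b \in squares); rewrite ?andbF.
have m1_non : -1 \in nonsquares by rewrite mem_nonsquares oppr_eq0 oner_eq0.
rewrite -sum1_card [RHS]big_mkcond; apply: eq_bigr => b _.
by rewrite mul_nonsquare_nonsquares //; case: (b \in squares).
Qed.

Lemma sum_convolution : (\sum_a convolution a = #|squares| * #|squares|)%N.
Proof.
rewrite /convolution exchange_big /=.
under eq_bigr => b _.
  rewrite -big_distrr /= (reindex_inj (addIr b)) /=.
  under eq_bigr do rewrite addrK.
  over.
rewrite -big_distrl /= -{2}card_nonsquares -!sum1_card.
congr (_ * _)%N; rewrite [RHS]big_mkcond; apply: eq_bigr => b _.
  by case: (_ \in _).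
by case: (_ \in _).
Qed.

(** With [h] the number of nonzero squares and [l] the common value outside 0,
    summing the convolution gives [convolution 0 + 2 * h * l = h ^ 2]. *)
Lemma convolution_values : exists l,
  (forall a, a != 0 -> convolution a = l) /\
  (  #|K| = (4 * l + 1)%N /\ convolution 0 = 0%N
  \/ #|K| = (4 * l + 3)%N /\ convolution 0 = (2 * l + 1)%N).
Proof.
exists (convolution 1); split; first exact: convolution_neq0.
set l := convolution 1.
have total := sum_convolution; have eq_card := card_squares.
rewrite (bigD1 0) //= (eq_bigr (fun=> l)) in total; last first.
  by move=> a; apply: convolution_neq0.
rewrite sum_nat_const in total.
have card_neq0 : #|[pred a : K | a != 0]| = #|squares|.*2.
  by have := cardC (pred1 (0 : K)); rewrite card1 add1n -eq_card => -[].
have {card_neq0} eq_card' : #|(fun a : K => a != 0)| = #|squares|.*2.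
  exact: card_neq0.
have h_gt0 : (0 < #|squares|)%N.
  rewrite card_gt0; apply/set0Pn; exists 1; apply/squareP.
  by exists 1; rewrite ?oner_neq0 ?expr1n.
rewrite {}eq_card' convolution0 in total *.
move: h_gt0 total; rewrite -eq_card; set h := #|squares| => h_gt0.
case: ifP => _ total; [left|right].
  suff : (l.*2 = h)%N by lia.
  by apply/eqP; rewrite -(eqn_pmul2l h_gt0); lia.
suff : (l.*2.+1 = h)%N by lia.
by apply/eqP; rewrite -(eqn_pmul2l h_gt0); lia.
Qed.

End Squares.

(** * Closed sequences of prime length *)

Section ClosedSequences.

Variables (F : finFieldType) (n : nat).
Hypothesis n_prime : prime n.

(** The ordinal [j] carries the term number [j + 1] of a closed sequence. *)
Definition residue (j : 'I_n) : 'F_n := j.+1%:R.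

Lemma natr_Fp_eq (a b : nat) : (a%:R == b%:R :> 'F_n) = (a == b %[mod n]).
Proof. by rewrite -val_eqE /= !val_Fp_nat. Qed.

Lemma residue_ordS (j : 'I_n) : residue (ordS j) = residue j + 1.
Proof.
apply/eqP; rewrite /residue -(natrD _ _ 1) natr_Fp_eq /=.
by rewrite -addn1 modnDml addn1.
Qed.

Lemma residue_bij : bijective residue.
Proof.
apply: inj_card_bij; last by rewrite card_Fp // card_ord.
move=> i j /eqP; rewrite natr_Fp_eq -addn1 -[j.+1]addn1 eqn_modDr.
by rewrite !modn_small // => /eqP/val_inj.
Qed.

(** Right multiplication by this matrix is a linear combination of the cyclic
    shifts, the shift by [b] having the coefficient [h b]. *)
Definition circulant (h : 'F_n -> F) : 'M[F]_n :=
  \matrix_(i, j) h (residue i - residue j).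

Lemma iter_Delta_circulant h (x : 'rV[F]_n) m :
  iter m (@Delta F n) (x *m circulant h) = iter m (@Delta F n) x *m circulant h.
Proof.
elim: m => //= m ->; move: (iter m _ x) => {}x.
apply/rowP => j; rewrite !mxE.
under [RHS]eq_bigr do rewrite !mxE mulrBl.
rewrite sumrB; congr (_ - _); last by apply: eq_bigr => i _; rewrite mxE.
rewrite (reindex_inj (@ordS_inj n)) /=; apply: eq_bigr => i _.
by rewrite !mxE !residue_ordS opprD addrACA subrr addr0.
Qed.

Lemma differential_operator_circulant (D : {linear 'rV[F]_n -> 'rV[F]_n}) h x :
  differential_operator D -> D (x *m circulant h) = D x *m circulant h.
Proof.
case=> m [d [_ eqD]]; rewrite !eqD mulmx_suml; apply: eq_bigr => i _.
by rewrite iter_Delta_circulant scalemxAl.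
Qed.

(** [D] has no constant term, so it factors through [Delta]. *)
Lemma eq_differential_operator (D : {linear 'rV[F]_n -> 'rV[F]_n}) x y :
  differential_operator D -> Delta x = Delta y -> D x = D y.
Proof.
case=> m [d [_ eqD]] eq_Delta; rewrite !eqD; apply: eq_big_nat => -[|i] // _.
by rewrite !iterSr eq_Delta.
Qed.

(** If circulants turn [x] into every sequence up to a constant, they turn
    [D^k x] into [D^k y] for all [k >= 1], so that every coincidence in the
    trajectory of [x], once [D] has been applied, is inherited by that of
    [y]. *)
Lemma almost_most_complicated_cyclic (x : 'rV[F]_n)
    (D : {linear 'rV[F]_n -> 'rV[F]_n}) :
  (forall y, exists h, Delta (x *m circulant h) = Delta y) ->
  differential_operator D -> almost_most_complicated D x.
Proof.
move=> cyclic diffD; apply: almost_most_complicated_dominating => y a b.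
have [h eq_Delta] := cyclic y.
have iterD_y k : iter k.+1 D y = iter k.+1 D x *m circulant h.
  elim: k => [|k IHk]; last first.
    by rewrite iterS IHk differential_operator_circulant.
  rewrite /= -differential_operator_circulant //.
  exact: eq_differential_operator diffD (esym eq_Delta).
by rewrite !iterD_y => ->.
Qed.

Lemma nonresidue_indicatorE (j : 'I_n) :
  nonresidue_indicator F n j.+1 = (residue j \in nonsquares 'F_n)%:R.
Proof.
have is_squareE a : is_square (a%:R : 'F_n)
    = [exists x : 'I_n, (x ^ 2 == a %[mod n])%N].
  apply/existsP/existsP => [[x /eqP eq_x]|[x eq_x]].
    have lt_x : (x < n)%N by rewrite -[X in (_ < X)%N](Fp_cast n_prime).
    exists (Ordinal lt_x); rewrite -natr_Fp_eq natrX /= natr_Zp.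
    by rewrite eq_x.
  by exists (x%:R); rewrite -natrX natr_Fp_eq.
rewrite /nonresidue_indicator /quadratic_residue; case: eqVneq => [eq_n|neq_n].
  rewrite /residue eq_n pchar_Fp_0 // mem_nonsquares ?eqxx //.
have lt_n : (j.+1 < n)%N by rewrite ltn_neqAle neq_n ltn_ord.
have -> /= : coprime j.+1 n.
  rewrite coprime_sym prime_coprime //; apply/negP => /(dvdn_leq (ltn0Sn j)).
  by rewrite leqNgt lt_n.
by rewrite inE is_squareE; case: [exists _, _].
Qed.

(** Convolving [f], the indicator of the nonsquares, with the indicator of the
    squares gives [e] times the unit impulse plus a constant, which [Delta] does
    not see; hence [f] convolved with the squares and with [y / e] is [y] up to
    a constant. *)
Lemma cyclic_nonresidue_indicator (l : nat) (e : F) :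
  e != 0 -> (forall a : 'F_n, (convolution a)%:R = l%:R + e * (a == 0)%:R) ->
  forall y : 'rV[F]_n, exists h,
    Delta (closed_seq n (nonresidue_indicator F n) *m circulant h) = Delta y.
Proof.
move=> e_neq0 convE y; set f := closed_seq _ _.
pose h (b : 'F_n) :=
  e^-1 * \sum_k y 0 k * (- b - residue k \in squares 'F_n)%:R.
exists h.
suff fh j : (f *m circulant h) 0 j = e^-1 * l%:R * \sum_k y 0 k + y 0 j.
  by apply/rowP => j; rewrite [LHS]mxE [RHS]mxE !fh opprD addrACA subrr add0r.
transitivity (e^-1 * \sum_k y 0 k * (convolution (residue j - residue k))%:R).
  rewrite mxE; under eq_bigr => i _.
    rewrite !mxE nonresidue_indicatorE // /h mulrCA mulr_sumr; over.
  rewrite -mulr_sumr exchange_big /=; congr (_ * _); apply: eq_bigr => k _.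
  under eq_bigr do rewrite mulrCA.
  rewrite -mulr_sumr; congr (_ * _).
  rewrite /convolution natr_sum.
  rewrite (reindex_inj (inv_inj (subKr (residue j - residue k)))) /=.
  rewrite (reindex residue) /=; last by apply: onW_bij; apply: residue_bij.
  apply: eq_bigr => i _; rewrite subKr natrM mulrC opprB.
  by rewrite addrAC.
under eq_bigr do rewrite convE mulrDr.
rewrite big_split /= -mulr_suml mulrDr mulrA mulrAC; congr (_ + _).
rewrite (bigD1 j) //= subrr eqxx mulr1 big1 ?addr0 => [|k k_neq_j].
  by rewrite mulrC mulfK.
rewrite subr_eq0 (inj_eq (bij_inj residue_bij)) eq_sym (negPf k_neq_j).
by rewrite !mulr0.
Qed.

End ClosedSequences.

(** * The integer closest to a quarter of the length *)

Lemma closest_integer_quarter (n : nat) (c : int) :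
  closest_integer (n%:R / 4%:R) c -> forall k : int,
  `|n%:Z - 4 * c| <= `|n%:Z - 4 * k|.
Proof.
move=> closest k; have := closest k.
have scale (m : int) :
    `|n%:R / 4%:R - m%:~R : rat| = `|n%:Z - 4 * m|%:~R / 4%:R.
  rewrite intr_norm -[X in _ = _ / X](@ger0_norm _ 4%:R) // -normf_div.
  by rewrite rmorphB rmorphM /=; congr `|_|; field.
by rewrite !scale ler_pM2r // ler_int.
Qed.

Theorem theorem2 (F : finFieldType) (p n : nat)
  (char_p : p \in [pchar F]) (n_prime : prime n) (n_odd : odd n)
  (n_neq_p : n != p)
  (c : int) (c_closest : closest_integer (n%:R / 4%:R) c)
  (p_ndvd_c : ~~ (p %| c)%Z) :
  D_complicated n (nonresidue_indicator F n).
Proof.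
move=> D; apply: almost_most_complicated_cyclic => //.
have odd_Fp : odd #|'F_n| by rewrite card_Fp.
have [l [conv_neq0 values]] := convolution_values odd_Fp.
have natr_neq0 (m : nat) : c = m -> m%:R != 0 :> F.
  by move=> eq_c; move: p_ndvd_c; rewrite eq_c dvdzE (dvdn_pcharf char_p).
have closest := closest_integer_quarter c_closest.
rewrite card_Fp // in values.
pose e : F := (convolution (0 : 'F_n))%:R - l%:R.
apply: (@cyclic_nonresidue_indicator _ _ n_prime l e) => [|a]; rewrite /e.
  (* [e] is [- l] for [n = 4 l + 1] and [l + 1] for [n = 4 l + 3]: the integer
     closest to [n / 4], up to sign. *)
  case: values => -[eq_n ->].
    rewrite sub0r oppr_eq0; apply: natr_neq0.
    by have := closest l; lia.
  have -> : (2 * l + 1 = l.+1 + l)%N by lia.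
  rewrite natrD addrK; apply: natr_neq0.
  by have := closest l.+1; lia.
have [->|a_neq0] := eqVneq a 0; first by rewrite mulr1 addrC subrK.
by rewrite mulr0 addr0 conv_neq0.
Qed.
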